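(* Let $\mathcal E$ be the set of parameters $\alpha \in (0,1)$ for which the map $T_\alpha$ does not have the matching property, i.e. for which there are no non-negative integers $M,N$ with $T_\alpha^M(\alpha) = T_\alpha^N(1-\alpha)$. Then $\mathcal E$ has Lebesgue measure zero and Hausdorff dimension $1$.
   Context: For $\alpha \in (0,1)$ let $D_\alpha = \bigcup_{n \ge 1} \big[ \frac{1}{n+\alpha}, \frac1n \big] \subseteq [0,1]$, let $D_\alpha^{\mathsf c} = [0,1]\setminus D_\alpha$, and let $I_\alpha = [\min\{\alpha,1-\alpha\},1]$. The flipped $\alpha$-continued fraction map $T_\alpha : I_\alpha \to I_\alpha$ is defined by $T_\alpha(x) = \frac1x - \lfloor \frac1x \rfloor$ if $x \in D_\alpha^{\mathsf c}$ and $T_\alpha(x) = 1 + \lfloor \frac1x \rfloor - \frac1x$ if $x \in D_\alpha$. The discontinuity points of $T_\alpha$ are the points $\frac1{k+\alpha}$, $k\ge1$, whose left and right limit values are $\alpha$ and $1-\alpha$ respectively; $T_\alpha$ is said to have matching if $T_\alpha^M(\alpha)=T_\alpha^N(1-\alpha)$ for some non-negative integers $M,N$. *)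

(* Defs.v *)
From HB Require Import structures.
From mathcomp Require Import all_boot all_order all_algebra.
From mathcomp Require Import all_classical all_reals all_analysis.
Set Implicit Arguments. Unset Strict Implicit. Unset Printing Implicit Defensive.
Import Order.TTheory GRing.Theory Num.Theory.
Import numFieldNormedType.Exports.
Local Open Scope classical_set_scope.
Local Open Scope ring_scope.

Section Flipped.
Variable R : realType.

Definition D_alpha (a : R) : set R :=
  [set x | exists n : nat, (1 <= n)%N /\ (n%:R + a)^-1 <= x /\ x <= n%:R^-1].

Definition flr (x : R) : R := (Num.floor x)%:~R.

(* flipped alpha-continued fraction map (defined on all of R; only its
   values on I_alpha matter, and the orbits of alpha, 1-alpha stay there) *)
Definition T_alpha (a : R) (x : R) : R :=
  if pselect (D_alpha a x) then 1 + flr x^-1 - x^-1 else x^-1 - flr x^-1.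

Definition I_alpha (a : R) : set R := `[Order.min a (1 - a), 1].

Definition has_matching (a : R) : Prop :=
  exists M N : nat, iter M (T_alpha a) a = iter N (T_alpha a) (1 - a).

Definition nonmatching_set : set R :=
  [set a | 0 < a < 1 /\ ~ has_matching a].

Local Open Scope ereal_scope.

(* diameter, with diam set0 = 0 *)
Definition diam (U : set R) : \bar R :=
  ereal_sup ([set 0] `|` [set (`|p.1 - p.2|)%:E | p in U `*` U]).

Definition diam_pow (s : R) (U : set R) : \bar R :=
  if pselect (U = set0) then 0 else (fine (diam U) `^ s)%:E.

Definition delta_cover (d : R) (A : set R) (U : nat -> set R) : Prop :=
  A `<=` \bigcup_n U n /\ forall n, diam (U n) <= d%:E.

Definition hausdorff_content (s d : R) (A : set R) : \bar R :=
  ereal_inf [set \sum_(0 <= n <oo) diam_pow s (U n) | U in delta_cover d A].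

(* H^s(A) = lim_{delta -> 0+} H^s_delta(A) = sup_{delta > 0} H^s_delta(A) *)
Definition hausdorff_measure (s : R) (A : set R) : \bar R :=
  ereal_sup [set hausdorff_content s d A | d in [set d : R | (0 < d)%R]].

Definition hausdorff_dim (A : set R) : \bar R :=
  ereal_inf [set s%:E | s in [set s : R | (0 <= s)%R /\ hausdorff_measure s A = 0]].

End Flipped.

(* Main.v *)
Require Import Defs.
From HB Require Import structures.
From mathcomp Require Import all_boot all_order all_algebra.
From mathcomp Require Import all_classical all_reals all_analysis.
From mathcomp Require Import ring lra zify.
Import Order.TTheory GRing.Theory Num.Theory.
Local Open Scope classical_set_scope.
Local Open Scope ring_scope.

(** Write [b = 1 - a] and let [G] be the Gauss map. If [a <= 1/2], the orbits of
[a] and [b] meet after two steps. If [a > 1/2], then as long as [G^k b] stays in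
[[b / (1 - b), 1 - b]] the two orbits follow the tails of even and odd index of
the continued fraction of [b]; the first time [G^k b] leaves this interval they
meet. Hence non-matching forces [b] to have bounded partial quotients, so these
parameters form a null set.

Conversely, if [b = [0; N+3, d_1, d_2, ...]] with [1 <= d_i <= N] and the [d_i]
are not ultimately periodic, there is no matching. Such parameters have dimension
close to [1] for large [N]: each cylinder is at most half as long as its parent,
so for [s < 1] the [s]-th powers of the lengths of the [N] children of a cylinder
sum to at least the [s]-th power of its length. A cover of too small [s]-cost, to
which the countably many ultimately periodic expansions are added, is replaced by
cylinders, and a greedy choice of digits produces an expansion avoiding them all. *)

(** * Continued fraction words and the lengths of their cylinders *)

Section Words.
Variable R : realType.
Implicit Types (w : seq nat) (x y : R).

(* Words are stored with the last digit first: extending an expansion is [cons],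
   and the cylinder of [w] contains that of [x] when [w] is a suffix of [x]. *)
Definition cf_map w x : R := foldl (fun y a => (a%:R + y)^-1) x w.

Lemma cf_map_cons a w x : cf_map (a :: w) x = cf_map w (a%:R + x)^-1.
Proof. by []. Qed.

(** The denominators [(q_n, q_(n-1))] of the last two convergents. *)
Fixpoint cf_den w : R * R :=
  if w is a :: w' then (a%:R * (cf_den w').1 + (cf_den w').2, (cf_den w').1)
  else (1, 0).

(** The length of the cylinder of [w]: the distance between the images of 0 and 1 under
    [cf_map w]. *)
Definition cf_len w : R :=
  ((cf_den w).1 * ((cf_den w).1 + (cf_den w).2))^-1.

Lemma natr_ge1 (a : nat) : (0 < a)%N -> 1 <= a%:R :> R.
Proof. by move=> a0; rewrite ler1n. Qed.

Lemma cf_den_bounds w : all (leq 1) w ->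
  1 <= (cf_den w).1 /\ 0 <= (cf_den w).2 <= (cf_den w).1.
Proof.
elim: w => [_|a w IH /andP[a1 /IH[q1 /andP[p0 pq]]]] /=.
  by split; rewrite ?lexx ?ler01.
have ha := natr_ge1 _ a1.
split; first by nra.
by apply/andP; split; nra.
Qed.

Lemma cf_len_gt0 w : all (leq 1) w -> 0 < cf_len w.
Proof.
move=> /cf_den_bounds[q1 /andP[p0 pq]].
by rewrite /cf_len invr_gt0; nra.
Qed.

(** [cf_map w] is a fractional linear map of determinant 1 or -1 with denominator [q + p x]. *)
Lemma cf_map_dist w x y : all (leq 1) w -> 0 <= x -> 0 <= y ->
  `|cf_map w x - cf_map w y| =
  `|x - y| / (((cf_den w).1 + (cf_den w).2 * x) * ((cf_den w).1 + (cf_den w).2 * y)).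
Proof.
elim: w x y => [|a w IH] x y; first by rewrite /= !mul0r !addr0 mulr1 divr1.
move=> /= /andP[a1 w1] x0 y0.
have ha := natr_ge1 _ a1.
have [q1 /andP[p0 pq]] := cf_den_bounds _ w1.
rewrite -!/(cf_map w _) IH //; last 2 first.
- by rewrite invr_ge0; nra.
- by rewrite invr_ge0; nra.
have ax : 0 < a%:R + x by nra.
have ay : 0 < a%:R + y by nra.
have -> : (a%:R + x)^-1 - (a%:R + y)^-1 = (y - x) / ((a%:R + x) * (a%:R + y)).
  by field; rewrite !gt_eqF.
rewrite normrM normfV (gtr0_norm (mulr_gt0 ax ay)) distrC.
set q := (cf_den w).1 in q1 pq *; set p := (cf_den w).2 in p0 pq *.
have h z : 0 <= z -> 0 < a%:R * q + p + q * z by move=> z0; nra.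
have h2 z : 0 <= z -> 0 < (a%:R + z) * q + p by move=> z0; nra.
field; rewrite !gt_eqF //; try exact: h; try exact: h2.
Qed.

Lemma cf_map_dist_ge w x y : all (leq 1) w -> 0 <= x <= 1 -> 0 <= y <= 1 ->
  `|x - y| * cf_len w / 2 <= `|cf_map w x - cf_map w y|.
Proof.
move=> w1 /andP[x0 x1] /andP[y0 y1]; rewrite cf_map_dist // -mulrA.
have [q1 /andP[p0 pq]] := cf_den_bounds _ w1.
set q := (cf_den w).1 in q1 pq *; set p := (cf_den w).2 in p0 pq *.
apply: ler_wpM2l => //; rewrite /cf_len -invfM lef_pV2 ?posrE; last 2 first.
- by nra.
- by apply: mulr_gt0; nra.
have : (q + p * x) * (q + p * y) <= (q + p) * (q + p) by apply: ler_pM; nra.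
by nra.
Qed.

Lemma cf_map_dist_le w x y : all (leq 1) w -> 0 <= x <= 1 -> 0 <= y <= 1 ->
  `|cf_map w x - cf_map w y| <= 2 * cf_len w.
Proof.
move=> w1 /andP[x0 x1] /andP[y0 y1]; rewrite cf_map_dist //.
have [q1 /andP[p0 pq]] := cf_den_bounds _ w1.
have h : `|x - y| <= 1 by rewrite ler_norml; apply/andP; split; lra.
set q := (cf_den w).1 in q1 pq *; set p := (cf_den w).2 in p0 pq *.
have d0 : 0 < (q + p * x) * (q + p * y) by apply: mulr_gt0; nra.
rewrite ler_pdivrMr // (le_trans h) // /cf_len -/q -/p mulrAC.
rewrite ler_pdivlMr; last by nra.
have : q * q <= (q + p * x) * (q + p * y) by apply: ler_pM; nra.
by nra.
Qed.

Lemma cf_len_child b w : all (leq 1) w -> (0 < b)%N -> cf_len (b :: w) <= cf_len w / 2.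
Proof.
move=> w1 b0; have [q1 /andP[p0 pq]] := cf_den_bounds _ w1.
have hb := natr_ge1 _ b0.
rewrite /cf_len /= -invfM.
set q := (cf_den w).1 in q1 pq *; set p := (cf_den w).2 in p0 pq *.
have bq : q <= b%:R * q by nra.
rewrite lef_pV2 ?posrE; last 2 first.
- by apply: mulr_gt0; lra.
- by nra.
have : (q + p) * (q + q) <= (b%:R * q + p) * (b%:R * q + p + q) by apply: ler_pM; lra.
by nra.
Qed.

Lemma cf_len_le w : all (leq 1) w -> cf_len w <= 2 ^- size w.
Proof.
elim: w => [_|a w IH /= /andP[a1 w1]]; first by rewrite /cf_len /= addr0 mulr1.
apply: (le_trans (cf_len_child _ _ w1 a1)).
by rewrite exprS invfM mulrC ler_pM2l ?invr_gt0 ?IH.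
Qed.

(** The terms telescope: each is a difference of two consecutive values of [1 / (q (b q + p))]. *)
Lemma cf_len_sum N w : all (leq 1) w ->
  \sum_(b < N) cf_len (b.+1 :: w) =
  cf_len w * (N%:R * (cf_den w).1 / (N.+1%:R * (cf_den w).1 + (cf_den w).2)).
Proof.
move=> w1; have [q1 /andP[p0 pq]] := cf_den_bounds _ w1.
rewrite /cf_len /=.
set q := (cf_den w).1 in q1 pq *; set p := (cf_den w).2 in p0 pq *.
elim: N => [|N IH]; first by rewrite big_ord0 !mul0r mulr0.
rewrite big_ord_recr /= IH -[N.+2]addn1 -[N.+1]addn1 !natrD.
have n0 : 0 <= N%:R :> R by [].
set n : R := N%:R in n0 *.
have h : 0 <= n * q by nra.
by field; rewrite !gt_eqF //; nra.
Qed.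

Lemma cf_len_sum_le N w : all (leq 1) w ->
  \sum_(b < N) cf_len (b.+1 :: w) <= N%:R / N.+1%:R * cf_len w.
Proof.
move=> w1; have [q1 /andP[p0 pq]] := cf_den_bounds _ w1.
rewrite cf_len_sum // mulrC ler_pM2r ?cf_len_gt0 //.
have n0 : 0 <= N%:R :> R by [].
rewrite -[N.+1]addn1 natrD.
set n : R := N%:R in n0 *.
set q := (cf_den w).1 in q1 pq *; set p := (cf_den w).2 in p0 pq *.
have h : 0 <= n * q by nra.
rewrite ler_pdivrMr; last by nra.
rewrite mulrAC ler_pdivlMr; last by lra.
by have := mulr_ge0 n0 p0; lra.
Qed.

Lemma cf_len_sum_ge N w : all (leq 1) w ->
  N%:R / N.+2%:R * cf_len w <= \sum_(b < N) cf_len (b.+1 :: w).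
Proof.
move=> w1; have [q1 /andP[p0 pq]] := cf_den_bounds _ w1.
rewrite cf_len_sum // [leRHS]mulrC ler_pM2r ?cf_len_gt0 //.
have n0 : 0 <= N%:R :> R by [].
rewrite -[N.+2]addn2 -[N.+1]addn1 !natrD.
set n : R := N%:R in n0 *.
set q := (cf_den w).1 in q1 pq *; set p := (cf_den w).2 in p0 pq *.
have h : 0 <= n * q by nra.
rewrite ler_pdivrMr; last by lra.
rewrite mulrAC ler_pdivlMr; last by nra.
by have : n * p <= n * q by [nra]; lra.
Qed.

Lemma mulr_powR_sub1 (x s : R) : 0 < x -> x * x `^ (s - 1) = x `^ s.
Proof.
move=> x0; rewrite -{1}[x]powRr1 ?ltW // -powRD ?subrKC //.
by rewrite (gt_eqF x0) implybT.
Qed.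

(* Each child has relative length at most 1/2, so replacing [s = 1] by [s < 1]
   gains a factor [2 `^ (1 - s)], which pays for the digits beyond [N]. *)
Lemma cf_len_powR_sum N w (s : R) : all (leq 1) w -> s <= 1 ->
  1 <= N%:R / N.+2%:R * 2 `^ (1 - s) ->
  cf_len w `^ s <= \sum_(b < N) cf_len (b.+1 :: w) `^ s.
Proof.
move=> w1 s1 hN.
have l0 := cf_len_gt0 _ w1.
have step (b : nat) : cf_len (b.+1 :: w) * (cf_len w / 2) `^ (s - 1) <= cf_len (b.+1 :: w) `^ s.
  have lb0 : 0 < cf_len (b.+1 :: w) by rewrite cf_len_gt0.
  rewrite -(mulr_powR_sub1 (cf_len (b.+1 :: w))) //.
  rewrite ler_pM2l // -[s - 1]opprB !powRN lef_pV2 ?posrE ?powR_gt0 ?divr_gt0 //.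
  apply: ge0_ler_powR; rewrite ?nnegrE ?subr_ge0 //; last exact: cf_len_child.
  - exact: ltW.
  - by rewrite divr_ge0 // ltW.
apply: (@le_trans _ _ (\sum_(b < N) cf_len (b.+1 :: w) * (cf_len w / 2) `^ (s - 1))); last first.
  by apply: ler_sum => b _; exact: step.
rewrite -mulr_suml.
apply: (@le_trans _ _ (N%:R / N.+2%:R * cf_len w * (cf_len w / 2) `^ (s - 1))); last first.
  by rewrite ler_wpM2r ?powR_ge0 // cf_len_sum_ge.
have -> : (cf_len w / 2) `^ (s - 1) = cf_len w `^ (s - 1) * 2 `^ (1 - s).
  rewrite powRM ?(ltW l0) ?invr_ge0 //.
  congr (_ * _).
  by rewrite -[2^-1]powR_inv1 // -powRrM mulN1r opprB.
have -> : N%:R / N.+2%:R * cf_len w * (cf_len w `^ (s - 1) * 2 `^ (1 - s)) =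
   (N%:R / N.+2%:R * 2 `^ (1 - s)) * (cf_len w * cf_len w `^ (s - 1)) by ring.
rewrite mulr_powR_sub1 //.
by rewrite ler_peMl // powR_ge0.
Qed.

(** Tails bounded away from 1 keep sibling cylinders apart: for [a < b], [b + v - (a + u)] is at
    least [1 - u]. *)
Lemma cf_map_gap N w (a b : nat) (u v : R) : all (leq 1) w ->
  (0 < a <= N)%N -> (0 < b <= N)%N -> a != b ->
  0 <= u <= 1 - N.+2%:R^-1 -> 0 <= v <= 1 - N.+2%:R^-1 ->
  cf_len w / (2 * N.+2%:R ^+ 3) <= `|cf_map (a :: w) u - cf_map (b :: w) v|.
Proof.
move=> w1.
wlog ab : a b u v / (a < b)%N.
  move=> hw ha hb ab hu hv.
  move: (ab); rewrite neq_ltn => /orP[|] h; first exact: hw.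
  by rewrite distrC; apply: hw => //; rewrite eq_sym.
move=> /andP[a0 aN] /andP[b0 bN] _ /andP[u0 u1] /andP[v0 v1].
set k : R := N.+2%:R in u1 v1 *.
have k0 : 0 < k by rewrite /k ltr0n.
have ki0 : 0 < k^-1 by rewrite invr_gt0.
have ak : a%:R + 1 <= k by rewrite /k -natr1 lerD2r ler_nat; lia.
have bk : b%:R + 1 <= k by rewrite /k -natr1 lerD2r ler_nat; lia.
have ha := natr_ge1 _ a0; have hb := natr_ge1 _ b0.
have abR : a%:R + 1 <= b%:R :> R by rewrite natr1 ler_nat.
clearbody k.
have inv01 (c : R) : 1 <= c -> 0 <= c^-1 <= 1.
  by move=> c1; rewrite invr_ge0 invf_le1 ?c1 ?andbT; lra.
apply: le_trans (cf_map_dist_ge w (a%:R + u)^-1 (b%:R + v)^-1 w1 _ _); last 2 first.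
- by apply: inv01; lra.
- by apply: inv01; lra.
have l0 := cf_len_gt0 _ w1.
have e : (a%:R + u)^-1 - (b%:R + v)^-1 = (b%:R + v - (a%:R + u)) / ((a%:R + u) * (b%:R + v)).
  by field; rewrite !gt_eqF //; lra.
have d0 : 0 < (a%:R + u) * (b%:R + v) by apply: mulr_gt0; lra.
have hk : k^-1 ^+ 3 <= `|(a%:R + u)^-1 - (b%:R + v)^-1|.
  rewrite e ger0_norm; last by apply: divr_ge0; [lra | exact: ltW].
  rewrite ler_pdivlMr //.
  apply: (@le_trans _ _ (k^-1 ^+ 3 * (k * k))).
    by rewrite ler_pM2l ?exprn_gt0 //; apply: ler_pM; lra.
  have -> : k^-1 ^+ 3 * (k * k) = k^-1 by field; rewrite gt_eqF.
  by lra.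
have -> : cf_len w / (2 * k ^+ 3) = k^-1 ^+ 3 * (cf_len w / 2) by field; rewrite gt_eqF.
by rewrite -mulrA ler_pM2r //; lra.
Qed.

End Words.

(** * The flipped map against the Gauss map: matching and non-matching *)

Section Dynamics.
Variable R : realType.
Implicit Types (a x t u : R).

Definition gauss x : R := x^-1 - flr x^-1.

Lemma flr_natD (n : nat) u : 0 <= u < 1 -> flr (n%:R + u) = n%:R.
Proof.
move=> /andP[u0 u1]; rewrite /flr (@floor_def _ _ n%:Z) // rmorphD /= -!pmulrn.
by rewrite lerDl u0 ltrD2l.
Qed.

Lemma gaussP x : 0 < x <= 1 ->
  exists n : nat, [/\ (0 < n)%N, x^-1 = n%:R + gauss x & 0 <= gauss x < 1].
Proof.
move=> /andP[x0 x1].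
have x1' : 1 <= x^-1 by rewrite -invr1 lef_pV2 ?posrE.
have f1 : 0 < Num.floor x^-1 by rewrite floor_gt0.
have fE : flr x^-1 = `|Num.floor x^-1|%N%:R.
  by rewrite /flr natr_absz ger0_norm // ltW.
exists `|Num.floor x^-1|%N; split; first lia.
  by rewrite /gauss fE subrKC.
have := floor_itv x^-1; rewrite /gauss /flr rmorphD /= => /andP[h1 h2].
by rewrite subr_ge0 h1 ltrBlDl.
Qed.

(** The point [x] lies in [D_alpha a] exactly when the fractional part [u] of [1 / x] is at most
    [a]; as [a < 1], only the index [n] can occur. *)
Lemma T_alphaE a x (n : nat) u : 0 < a < 1 -> 0 < x -> (0 < n)%N ->
  x^-1 = n%:R + u -> 0 <= u < 1 -> T_alpha a x = if u <= a then 1 - u else u.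
Proof.
move=> /andP[a0 a1] x0 n0 xE u01; have /andP[u0 u1] := u01.
have xV : x = (n%:R + u)^-1 by rewrite -xE invrK.
have n1 : 1 <= n%:R :> R by rewrite ler1n.
rewrite /T_alpha xE flr_natD //; case: pselect => h; case: (leP u a) => ua; try ring.
- case: h => m [m0 [h1 h2]]; exfalso.
  have m1 : 1 <= m%:R :> R by rewrite ler1n.
  move: h1 h2; rewrite xV !lef_pV2 ?posrE; try lra.
  move=> h1 h2.
  have mn : (m < n.+1)%N by rewrite -(ltr_nat R) -natr1; lra.
  have nm : (n < m.+1)%N by rewrite -(ltr_nat R) -natr1; lra.
  by have mE : m = n by [lia]; rewrite mE in h1; lra.
- exfalso; apply: h; exists n; split=> //.
  by rewrite xV !lef_pV2 ?posrE; try lra; split; lra.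
Qed.

Lemma T_alpha_flip a x (n : nat) u : 0 < a < 1 -> 0 < x -> (0 < n)%N ->
  x^-1 = n%:R + u -> 0 <= u < 1 -> u <= a -> T_alpha a x = 1 - u.
Proof. by move=> a01 x0 n0 xE u01 ua; rewrite (T_alphaE a x n u) // ua. Qed.

Lemma T_alpha_keep a x (n : nat) u : 0 < a < 1 -> 0 < x -> (0 < n)%N ->
  x^-1 = n%:R + u -> 0 <= u < 1 -> a < u -> T_alpha a x = u.
Proof. by move=> a01 x0 n0 xE u01 ua; rewrite (T_alphaE a x n u) // leNgt ua. Qed.

Lemma T_alpha_congr a x x' (n n' : nat) u : 0 < a < 1 -> 0 < x -> 0 < x' ->
  (0 < n)%N -> (0 < n')%N -> x^-1 = n%:R + u -> x'^-1 = n'%:R + u -> 0 <= u < 1 ->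
  T_alpha a x = T_alpha a x'.
Proof.
by move=> a01 x0 x0' n0 n0' xE xE' u01; rewrite (T_alphaE a x n u) // (T_alphaE a x' n' u).
Qed.

(** Below 1/2, [1 / (1 - a) = 1 + a / (1 - a)], and inverting [a / (1 - a)] gives [1 / a - 1], with
    the fractional part of [1 / a]. Hence [T a = T (T (1 - a))]. *)
Lemma has_matching_le_half a : 0 < a <= 2^-1 -> has_matching a.
Proof.
move=> /andP[a0]; rewrite le_eqVlt => /predU1P[->|a1].
  by exists 0%N, 0%N => /=; lra.
have a01 : 0 < a < 1 by apply/andP; split; lra.
have [|n [n0 aE g01]] := gaussP a; first by apply/andP; split; lra.
have h1 : T_alpha a (1 - a) = a / (1 - a).
  apply: (T_alpha_keep a _ 1) => //; first lra.
  - by field; rewrite gt_eqF; lra.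
  - rewrite divr_ge0 /=; try lra.
    by rewrite ltr_pdivrMr; lra.
  - by rewrite ltr_pdivlMr; nra.
have n2 : (1 < n)%N.
  rewrite -(ltr_nat R); have : 2 < a^-1 by rewrite -[2]invrK ltf_pV2 ?posrE; lra.
  by rewrite aE; lra.
exists 1%N, 2%N; rewrite /= h1.
apply: (T_alpha_congr a _ _ n n.-1 (gauss a)) => //; try lia.
  by rewrite divr_gt0; lra.
have -> : n.-1%:R = n%:R - 1 :> R by rewrite -[in RHS](prednK n0) -natr1 addrK.
have -> : (a / (1 - a))^-1 = a^-1 - 1 by field; rewrite !gt_eqF; lra.
by rewrite aE; ring.
Qed.

(* On the side of [1 - t], [T_alpha a] acts as [w |-> w - 1] on [w = 1 / t]. *)
Lemma T_alpha_onem_inv a w : 2^-1 < a < 1 -> 2 < w -> (w - 1)^-1 <= a ->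
  T_alpha a (1 - w^-1) = 1 - (w - 1)^-1.
Proof.
move=> /andP[a1 a2] w2 wa.
have w0 : 0 < w^-1 by rewrite invr_gt0; lra.
have w1 : w^-1 < 1 by rewrite invf_lt1; lra.
apply: (T_alpha_flip a _ 1) => //; try lra.
- field; rewrite !gt_eqF //; lra.
- by rewrite invr_ge0 invf_lt1; try lra; apply/andP; split; lra.
Qed.

Lemma iter_T_alpha_onem_inv a w (k : nat) : 2^-1 < a < 1 -> 2 <= w - k%:R ->
  iter k (T_alpha a) (1 - w^-1) = 1 - (w - k%:R)^-1.
Proof.
move=> a01; elim: k => [|k IH]; first by rewrite subr0.
rewrite -natr1 => hk; rewrite iterS IH; last lra.
rewrite T_alpha_onem_inv //; first by congr (1 - _^-1); ring.
  by lra.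
have /andP[a1 _] := a01; apply: le_trans (ltW a1).
by rewrite lef_pV2 ?posrE; lra.
Qed.

(** The third hypothesis is an invariant: the orbits of [1 - t] and [T t] stand in for those of [a]
    and [1 - a]. With [1 / t = n + g] one finds [T t = 1 - g] and [T^n (1 - t) = T g], so it passes
    to [g] with the two orbits swapped; every other case yields matching. *)
Lemma nonmatching_gauss_step a t : 2^-1 < a < 1 -> ~ has_matching a ->
  (forall i j, iter i (T_alpha a) (1 - t) = iter j.+1 (T_alpha a) t -> has_matching a) ->
  1 - a <= t <= a ->
  1 - a <= gauss t <= a /\
  (forall i j, iter i (T_alpha a) (1 - gauss t) = iter j.+1 (T_alpha a) (gauss t) ->
    has_matching a).
Proof.
move=> a01 nomatch H /andP[t1 t2]; have /andP[a1 a2] := a01.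
have a01' : 0 < a < 1 by apply/andP; split; lra.
have [|n [n0 tE g01]] := gaussP t; first by apply/andP; split; lra.
have /andP[g0 g1] := g01; set g := gauss t in tE g01 g0 g1 *.
have tV : t = (n%:R + g)^-1 by rewrite -tE invrK.
have t0 : 0 < t by lra.
have [An [gp Ag]] : iter n.-1 (T_alpha a) (1 - t) = 1 - (1 + g)^-1 /\
    0 < g /\ (1 + g)^-1 <= a.
  case: n n0 tE tV => [//|[|m]] _ tE tV.
    rewrite tV in t2 *; split=> //; split=> //.
    rewrite lt_neqAle g0 andbT; apply/eqP => gE.
    by move: t2; rewrite -gE addr0 invr1; lra.
  have it : iter m (T_alpha a) (1 - t) = 1 - (2 + g)^-1.
    have e : t^-1 - m%:R = 2 + g by rewrite tE -!natr1; ring.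
    by rewrite -{1}[t]invrK iter_T_alpha_onem_inv ?e //; lra.
  (* At [g = 0] both orbits reach 1. *)
  move: g0; rewrite le_eqVlt => /predU1P[gE|gp].
    exfalso; apply/nomatch/(H m.+1 0%N).
    rewrite iterS it -gE addr0 /=.
    have u01 : 0 <= (0 : R) < 1 by rewrite lexx ltr01.
    rewrite (T_alpha_flip a t m.+2 0) // ?tE -?gE //; last lra.
    by apply: (T_alpha_flip a _ 2 0) => //; [lra | field | lra].
  have hK : (1 - (2 + g)^-1)^-1 = 1%:R + (1 + g)^-1.
    by field; rewrite !gt_eqF; lra.
  have [ga|ga] := leP (1 + g)^-1 a.
    rewrite [m.+2.-1]/= iterS it T_alpha_onem_inv //; try lra.
      by split=> //; congr (1 - _^-1); ring.
    by have -> : 2 + g - 1 = 1 + g by ring.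
  (* Here the unflipped branch leads to [1 / (1 + g)], whose inverse shares its fractional part with
     [1 / t]. *)
  exfalso; apply/nomatch/(H m.+2 0%N).
  have -> : iter m.+2 (T_alpha a) (1 - t) = T_alpha a (T_alpha a (1 - (2 + g)^-1)).
    by rewrite !iterS it.
  have g1V : (1 + g)^-1 < 1 by rewrite invf_lt1; lra.
  rewrite (T_alpha_keep a (1 - (2 + g)^-1) 1 (1 + g)^-1) //.
  - apply: (T_alpha_congr a _ _ 1 m.+2 g) => //; last by rewrite invrK.
    by rewrite invr_gt0; lra.
  - by rewrite subr_gt0 invf_lt1; lra.
  - by rewrite invr_ge0 g1V andbT; lra.
(* The inverse of [1 - 1 / (1 + g)] is [1 + 1 / g], with the fractional part of [1 / g]. *)
have Tg : iter n (T_alpha a) (1 - t) = T_alpha a g.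
  rewrite -(prednK n0) iterS An.
  have [|m [m0 gE gg]] := gaussP g; first by rewrite gp ltW.
  apply: (T_alpha_congr a _ _ m.+1 m (gauss g)) => //.
    by rewrite subr_gt0 invf_lt1; lra.
  have -> : (1 - (1 + g)^-1)^-1 = 1 + g^-1 by field; rewrite !gt_eqF; lra.
  by rewrite gE -natr1; ring.
have gl : 1 - a <= g.
  move: Ag; rewrite -[(1 + g)^-1]mul1r ler_pdivrMr; last lra.
  by nra.
have [ga|ga] := leP g a.
  have Tt : T_alpha a t = 1 - g by apply: (T_alpha_flip a t n).
  split; first by rewrite gl.
  move=> i j; rewrite -Tt -iterSr [in RHS]iterSr -Tg -iterD => e.
  by apply: (H (j + n)%N i).
(* If [g > a], then [T t = g] and the orbits meet at [T g]. *)
have Tt : T_alpha a t = g by apply: (T_alpha_keep a t n).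
by exfalso; apply/nomatch/(H n 1%N); rewrite Tg /= Tt.
Qed.

(** The step is iterated from [t = 1 - a], where [1 - t] is [a] itself; the lower bound caps all
    partial quotients by [1 / (1 - a)]. *)
Lemma nonmatching_gauss_ge a (k : nat) : 0 < a < 1 -> ~ has_matching a ->
  1 - a <= iter k gauss (1 - a) <= a.
Proof.
move=> /andP[a0 a1] nomatch.
have [ah|ah] := leP a 2^-1.
  by exfalso; apply/nomatch/has_matching_le_half; rewrite a0.
have a01 : 2^-1 < a < 1 by rewrite ah.
suff [] : 1 - a <= iter k gauss (1 - a) <= a /\
  (forall i j, iter i (T_alpha a) (1 - iter k gauss (1 - a)) =
     iter j.+1 (T_alpha a) (iter k gauss (1 - a)) -> has_matching a) by [].
elim: k => [|k [IH1 IH2]]; last by rewrite iterS; exact: nonmatching_gauss_step.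
split; first by apply/andP; split=> /=; lra.
by move=> i j /=; rewrite subKr -iterS => e; exists i, j.+1.
Qed.

Lemma natrD_inj (c c' : nat) (u u' : R) : 0 <= u < 1 -> 0 <= u' < 1 ->
  c%:R + u = c'%:R + u' -> u = u'.
Proof.
move=> u01 u01' e; have := congr1 (@flr R) e; rewrite !flr_natD // => ec.
by move: e; rewrite ec => /addrI.
Qed.

(* Only the flipped branch is ever used, so the orbits of [a] and [1 - a] run
   through the tails of the expansion of [1 - a] of even and odd index. *)
Lemma nonmatching_of_expansion a (d : nat -> nat) (t : nat -> R) : 2^-1 < a < 1 ->
  t 0%N = 1 - a -> (forall k, (0 < d k)%N) -> (forall k, 0 < t k < 1) ->
  (forall k, (t k)^-1 = (d k)%:R + t k.+1) ->
  (forall k, t k.+1 <= a) -> (forall k, (1 + t k.+1)^-1 <= a) ->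
  (forall i j, t i.+1 = t j.+1 -> i = j) ->
  ~ has_matching a.
Proof.
move=> a01 t0E d0 t01 tE ta ta' tinj.
have a01' : 0 < a < 1 by have /andP[? ?] := a01; apply/andP; split; lra.
have tV k : t k = ((d k)%:R + t k.+1)^-1 by rewrite -tE invrK.
have tw k : 0 <= t k < 1 by have /andP[h ->] := t01 k; rewrite ltW.
(* An invariant class: [T_alpha] lowers [c] by one while [c >= 2], and from [c = 1] moves on to
   index [i + 2], so the parity [p] persists. *)
pose Z p z := exists i c : nat, [/\ odd i = p, (0 < c)%N & z = 1 - (c%:R + t i.+1)^-1].
have ZT p z : Z p z -> Z p (T_alpha a z).
  move=> [i [c [ip c0 ->]]].
  have /andP[h0 h1] := t01 i.+1.
  case: c c0 => [//|[|c]] _.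
    exists i.+2, (d i.+2); split=> //; first by rewrite /= negbK.
    rewrite -tV; apply: (T_alpha_flip a _ (d i.+1).+1) => //.
    - by rewrite subr_gt0 invf_lt1; lra.
    - have -> : (d i.+1).+1%:R + t i.+2 = 1 + (t i.+1)^-1 by rewrite tE -natr1; ring.
      by field; rewrite !gt_eqF; lra.
  exists i, c.+1; split=> //.
  have cR : 0 <= c%:R :> R by [].
  have e : c.+2%:R + t i.+1 - 1 = c.+1%:R + t i.+1 by rewrite -!natr1; ring.
  rewrite T_alpha_onem_inv ?e //; first by rewrite -!natr1; lra.
  apply: le_trans (ta' i); rewrite lef_pV2 ?posrE -?natr1; lra.
have Zit p z k : Z p z -> Z p (iter k (T_alpha a) z).
  by move=> hz; elim: k => [//|k IH]; rewrite iterS; exact: ZT.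
have Za : Z false a.
  by exists 0%N, (d 0%N); split=> //; rewrite -tV t0E subKr.
have Zb : Z true (T_alpha a (1 - a)).
  exists 1%N, (d 1%N); split=> //; rewrite -tV -t0E.
  apply: (T_alpha_flip a _ (d 0%N)) => //.
  by have /andP[] := t01 0%N.
have Zdisj z : Z false z -> Z true z -> False.
  move=> [i [c [ip c0 ->]]] [j [c' [jp c0' e]]].
  have e' : c%:R + t i.+1 = c'%:R + t j.+1.
    by apply: invr_inj; apply: oppr_inj; apply: (addrI 1).
  have := natrD_inj _ _ _ _ (tw _) (tw _) e' => /tinj ij.
  by move: ip; rewrite ij jp.
(* Both orbits are advanced once more, since the class of the second is established from [T (1 - a)]
   on. *)
case=> M [N e]; apply: (Zdisj (iter M.+1 (T_alpha a) a)); first exact: Zit.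
by rewrite iterS e -iterS iterSr; exact: Zit.
Qed.

End Dynamics.

(** * Lebesgue measure zero through bounded partial quotients *)

Section Null.
Variable R : realType.
Local Notation mu := (@lebesgue_measure R).

Definition bounded_type (N : nat) : set R :=
  [set x | forall k, 0 < iter k (@gauss R) x <= 1 /\ (iter k (@gauss R) x)^-1 < N.+1%:R].

(** Splitting by the next digit replaces a cylinder by [N] children of total length at most
    [N / (N + 1)] times its own; [k] levels give a geometric factor. *)
Lemma bounded_type_cover N (k : nat) w : all (leq 1) w ->
  exists A : set R, [/\ measurable A, (fun x => 1 - cf_map R w x) @` bounded_type N `<=` A
    & (mu A <= (4 * (N%:R / N.+1%:R) ^+ k * cf_len R w)%:E)%E].
Proof.
elim: k w => [|k IH] w w1.
  have l0 := @cf_len_gt0 R _ w1.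
  (* The radius comes from [cf_map_dist_le]; the full width gives the factor 4. *)
  exists (`[1 - cf_map R w 0 - 2 * cf_len R w, 1 - cf_map R w 0 + 2 * cf_len R w]%classic); split.
  - exact: measurable_itv.
  - move=> _ [x xb <-] /=; rewrite in_itv /=.
    have /andP[x0 x1] := (xb 0%N).1.
    have : `|cf_map R w x - cf_map R w 0| <= 2 * cf_len R w.
      by apply: cf_map_dist_le; rewrite ?lexx ?ler01 // x1 andbT ltW.
    by rewrite ler_norml => /andP[h1 h2]; apply/andP; split; lra.
  - rewrite lebesgue_measure_itv /= lte_fin ifT; last by lra.
    by rewrite -EFinD lee_fin expr0; lra.
have /choice[A hA] : forall b : nat, exists A : set R, [/\ measurable A,
    (fun x => 1 - cf_map R (b.+1 :: w) x) @` bounded_type N `<=` A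
  & (mu A <= (4 * (N%:R / N.+1%:R) ^+ k * cf_len R (b.+1 :: w))%:E)%E].
  by move=> b; apply: IH.
exists (\big[setU/set0]_(b < N) A b); split.
- by apply: bigsetU_measurable => b _; have [] := hA b.
- move=> _ [x xb <-].
  have [x01 xN] := xb 0%N; have /andP[x0 x1] := x01; rewrite /= in xN x0 x1.
  have [n [n0 xE g01]] := gaussP _ _ x01; rewrite /= in xE.
  have nN : (n.-1 < N)%N.
    suff : (n < N.+1)%N by lia.
    rewrite -(ltr_nat R); apply: le_lt_trans xN.
    by rewrite xE lerDl; case/andP: g01.
  rewrite -(bigcup_mkord N A); exists n.-1 => //.
  have [_ sub _] := hA n.-1; apply: sub.
  exists (gauss R x); first by move=> j; rewrite -iterSr; exact: xb.
  by rewrite cf_map_cons prednK // -xE invrK.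
- apply: (le_trans (Boole_inequality _ _)) => [b _|]; first by have [] := hA b.
  apply: (@le_trans _ _ (\sum_(b < N) (4 * (N%:R / N.+1%:R) ^+ k * cf_len R (b.+1 :: w))%:E)%E).
    by apply: lee_sum => b _; have [] := hA b.
  rewrite sumEFin lee_fin -mulr_sumr exprSr mulrA -!mulrA.
  rewrite ler_pM2l // ler_wpM2l ?exprn_ge0 ?divr_ge0 // mulrA.
  exact: cf_len_sum_le.
Qed.

Lemma bounded_type_null N : mu.-negligible ((fun x => 1 - x) @` bounded_type N).
Proof.
have /choice[A hA] := fun k => bounded_type_cover N k [::] isT.
exists (\bigcap_k A k); split.
- by apply: bigcapT_measurable => k; have [] := hA k.
- apply/eqP; rewrite eq_le measure_ge0 andbT; apply/lee_addgt0Pr => e e0; rewrite add0e.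
  have r1 : `|N%:R / N.+1%:R : R| < 1.
    by rewrite ger0_norm ?divr_ge0 // ltr_pdivrMr // mul1r ltr_nat.
  have e4 : 0 < e / 4 by rewrite divr_gt0.
  have [K _ /(_ K (leqnn K))/= hK] := cvgr0_norm_lt _ (cvg_expr r1) _ e4.
  have [mK _ leK] := hA K.
  apply: (@le_trans _ _ (mu (A K))).
    apply: le_measure; rewrite ?inE //; last by move=> x; apply.
    by apply: bigcapT_measurable => k; have [] := hA k.
  apply: (le_trans leK); rewrite lee_fin /cf_len /= addr0 mulr1 invr1 mulr1.
  move: hK; rewrite ger0_norm ?exprn_ge0 ?divr_ge0 // => hK.
  by rewrite mulrC -ler_pdivlMr // ltW.
- by move=> y yb k _; have [_ sub _] := hA k; exact: sub.
Qed.

Lemma nonmatching_null : mu.-negligible (@nonmatching_set R).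
Proof.
apply: (negligibleS _ (negligible_bigcup bounded_type_null)) => a [a01 nomatch].
have [a0 a1] := andP a01.
have b0 : 0 < 1 - a by lra.
exists (Num.trunc (1 - a)^-1) => //; exists (1 - a); last by rewrite subKr.
move=> k; have /andP[h1 h2] := @nonmatching_gauss_ge R a k a01 nomatch.
split; first by apply/andP; split; lra.
apply: le_lt_trans (truncnS_gt _).
by rewrite lef_pV2 ?posrE //; lra.
Qed.
End Null.

(** * Hausdorff dimension at most 1 *)

Section DimLe.
Variable R : realType.
Local Open Scope ereal_scope.

Lemma diam_le (U : set R) (d : R) : (0 <= d)%R ->
  (forall x y, U x -> U y -> (`|x - y| <= d)%R) -> diam U <= d%:E.
Proof.
move=> d0 h; apply: ge_ereal_sup => y [->|]; first by rewrite lee_fin.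
by move=> [[x z] [/= Ux Uz] <-]; rewrite lee_fin h.
Qed.

Lemma diam_ge0 (U : set R) : 0 <= diam U.
Proof. by apply: ereal_sup_ubound; left. Qed.

Lemma diam_pow_le (U : set R) (s d : R) : (0 < s)%R -> (0 <= d)%R -> diam U <= d%:E ->
  diam_pow s U <= (d `^ s)%:E.
Proof.
move=> s0 d0 h; rewrite /diam_pow; case: pselect => ?; first by rewrite lee_fin powR_ge0.
have f : diam U \is a fin_num by rewrite ge0_fin_numE ?diam_ge0 // (le_lt_trans h) ?ltry.
rewrite lee_fin ge0_ler_powR ?nnegrE ?fine_ge0 ?diam_ge0 ?(ltW s0) //.
by rewrite -lee_fin fineK.
Qed.

Lemma diam_pow_ge0 (U : set R) (s : R) : 0 <= diam_pow s U.
Proof. by rewrite /diam_pow; case: pselect => ?; rewrite ?lee_fin ?powR_ge0. Qed.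

(** Cutting into [n] intervals of length [1 / n] costs [n^(1 - s)], which tends to 0. *)
Lemma hausdorff_measure_unit_itv0 (A : set R) (s : R) : (1 < s)%R ->
  A `<=` [set x | (0 <= x < 1)%R] -> hausdorff_measure s A = 0.
Proof.
move=> s1 A01; apply/eqP; rewrite eq_le; apply/andP; split; last first.
  apply: le_ereal_sup_tmp; exists (hausdorff_content s 1 A); first by exists 1%R => //=; exact: ltr01.
  apply: le_ereal_inf_tmp => _ [U _ <-].
  by apply: nneseries_ge0 => n _ _; exact: diam_pow_ge0.
apply: ge_ereal_sup => _ [d /= d0 <-]; apply/lee_addgt0Pr => e e0; rewrite add0e.
have [N Nbig] : exists N : nat, (d^-1 < N.+1%:R /\ (e `^ (1 - s)^-1) < N.+1%:R)%R.
  exists (Num.trunc (d^-1 + e `^ (1 - s)^-1))%R.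
  have h := truncnS_gt (d^-1 + e `^ (1 - s)^-1)%R.
  have p1 : (0 <= d^-1)%R by rewrite invr_ge0 ltW.
  have p2 := powR_ge0 e (1 - s)^-1.
  by split; lra.
case: Nbig => Nd Ne.
pose n : R := N.+1%:R.
have n0 : (0 < n)%R by rewrite /n ltr0n.
pose U (i : nat) : set R := [set x | (i < N.+1)%N /\ (i%:R <= x * n <= i.+1%:R)%R].
have dU i : diam (U i) <= (n^-1)%:E.
  apply: diam_le; first by rewrite invr_ge0 ltW.
  move=> x y [_ /andP[x1 x2]] [_ /andP[y1 y2]].
  rewrite -(ler_pM2r n0) mulVf ?gt_eqF // -{1}(gtr0_norm n0) -normrM mulrBl.
  by move: x2 y2; rewrite -!natr1 ler_norml => x2 y2; apply/andP; split; lra.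
apply: ge_ereal_inf; exists (\sum_(0 <= i <oo) diam_pow s (U i)).
  exists U => //; split.
    move=> x /A01 /= /andP[x0 x1].
    have xn0 : (0 <= x * n)%R by rewrite mulr_ge0 // ltW.
    exists (Num.trunc (x * n)) => //; split.
      rewrite -(ltr_nat R); apply: (@le_lt_trans _ _ (x * n)%R); last by rewrite -/n; nra.
      by rewrite truncn_le.
    by have /andP[-> /ltW ->] := truncn_itv xn0.
  move=> i; apply: (le_trans (dU i)); rewrite lee_fin -[leRHS]invrK.
  by rewrite lef_pV2 ?posrE ?invr_gt0 // ltW.
rewrite (nneseries_split 0 N.+1); last by move=> k _; exact: diam_pow_ge0.
(* Past index [N] the sets are empty and cost 0. *)
rewrite add0n [X in _ + X]eseries0 ?adde0; last first.
  move=> i Ni _; rewrite /diam_pow; case: pselect => //= -[].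
  by apply/seteqP; split=> // x [] ; lia.
apply: (@le_trans _ _ (\sum_(0 <= i < N.+1) (n^-1 `^ s)%:E)).
  apply: lee_sum => i _; apply: diam_pow_le => //; first by lra.
  by rewrite invr_ge0 ltW.
rewrite sumEFin sumr_const_nat subn0 lee_fin -mulr_natl -/n.
have -> : (n * n^-1 `^ s)%R = (n `^ (1 - s))%R.
  rewrite -[(n^-1)%R]powR_inv1 ?(ltW n0) // -powRrM mulN1r -{1}[n]powRr1 ?(ltW n0) //.
  by rewrite -powRD // (gt_eqF n0) implybT.
have -> : e = ((e `^ (1 - s)^-1) `^ (1 - s))%R.
  by rewrite -powRrM mulVf ?powRr1 ?(ltW e0) // lt_eqF //; lra.
rewrite -[(1 - s)%R]opprB !powRN lef_pV2 ?posrE ?powR_gt0 //.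
apply: ge0_ler_powR; rewrite ?nnegrE ?powR_ge0 ?subr_ge0 //; [exact: ltW | by rewrite opprB ltW].
Qed.

Lemma hausdorff_dim_unit_itv (A : set R) :
  A `<=` [set x | (0 <= x < 1)%R] -> hausdorff_dim A <= 1.
Proof.
move=> A01; apply/lee_addgt0Pr => e e0.
apply: ereal_inf_lbound; exists (1 + e)%R; last by rewrite EFinD.
by split; [lra | apply: hausdorff_measure_unit_itv0 => //; lra].
Qed.
End DimLe.

(** * Real numbers with prescribed continued fraction digits *)

Section Expansions.
Variable R : realType.

Fixpoint cf_prefix (d : nat -> nat) (k : nat) : seq nat :=
  if k is k'.+1 then d k' :: cf_prefix d k' else [::].

Lemma size_cf_prefix d k : size (cf_prefix d k) = k.
Proof. by elim: k => //= k ->. Qed.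

Lemma all_cf_prefix d k : (forall i, (0 < d i)%N) -> all (leq 1) (cf_prefix d k).
Proof. by move=> d0; elim: k => //= k ->; rewrite d0. Qed.

Lemma eq_cf_prefix d d' k : (forall i, (i < k)%N -> d i = d' i) ->
  cf_prefix d k = cf_prefix d' k.
Proof.
elim: k => //= k IH h; rewrite h ?ltnSn // IH // => i ik.
by apply: h; rewrite ltnW.
Qed.

Lemma cf_prefix_catE d n m : (n <= m)%N -> exists v, cf_prefix d m = v ++ cf_prefix d n.
Proof.
move=> nm; elim: m nm => [|m IH]; first by rewrite leqn0 => /eqP ->; exists [::].
rewrite leq_eqVlt => /predU1P[->|/IH[v ve]]; first by exists [::].
by exists (d m :: v); rewrite /= ve.
Qed.

Lemma cf_prefix_rcons d n :
  cf_prefix d n.+1 = rcons (cf_prefix (fun i => d i.+1) n) (d 0%N).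
Proof. by elim: n => //= n <-. Qed.

(** [t k] is the tail [[0; d k, d (k+1), ...]]; all tails are carried along at once. *)
Definition cf_expansion (d : nat -> nat) (t : nat -> R) :=
  forall k, 0 < t k < 1 /\ t k = ((d k)%:R + t k.+1)^-1.

Lemma cf_expansion_prefix d t k : cf_expansion d t ->
  t 0%N = cf_map R (cf_prefix d k) (t k).
Proof.
by move=> dt; elim: k => // k ->; rewrite [cf_prefix _ _]/= cf_map_cons -(dt k).2.
Qed.

(** The intervals of radius [e n] about [u n] meet pairwise, so the supremum of their left ends lies
    in all of them. *)
Lemma sup_squeeze (u e : nat -> R) :
  (forall n m, (n <= m)%N -> `|u n - u m| <= e n) ->
  exists x, forall n, `|x - u n| <= e n.
Proof.
move=> h.
have hle k m : u k - e k <= u m + e m.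
  have em : 0 <= e m by apply: le_trans (h m m (leqnn m)).
  have ek : 0 <= e k by apply: le_trans (h k k (leqnn k)).
  have [km|/ltnW mk] := leqP k m.
    by have := h _ _ km; rewrite ler_norml => /andP[? ?]; lra.
  by have := h _ _ mk; rewrite ler_norml => /andP[? ?]; lra.
pose S := range (fun k => u k - e k).
have S0 : S !=set0 by exists (u 0%N - e 0%N), 0%N.
have Sub m : ubound S (u m + e m) by move=> _ [k _ <-].
exists (sup S) => m; rewrite ler_norml; apply/andP; split.
  suff : u m - e m <= sup S by lra.
  by apply: ub_le_sup; [exists (u 0%N + e 0%N) | exists m].
suff : sup S <= u m + e m by lra.
exact: ge_sup.
Qed.

Lemma exists_exprV2_lt (e : R) : 0 < e -> exists n : nat, 2 ^- n < e.
Proof.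
move=> e0; have h : `|2^-1 : R| < 1 by rewrite ger0_norm; lra.
have [K _ /(_ K (leqnn K))/=] := cvgr0_norm_lt _ (cvg_expr h) _ e0.
by rewrite ger0_norm ?exprn_ge0 // exprVn => hK; exists K.
Qed.

Lemma le0_exprV2 (x C : R) : (forall n, x <= C * 2 ^- n) -> x <= 0.
Proof.
move=> h; rewrite leNgt; apply/negP => x0.
have C0 : 0 < C.
  by have := h 0%N; rewrite expr0 invr1; lra.
have [n hn] := exists_exprV2_lt (x / C) (divr_gt0 x0 C0).
have := h n; rewrite leNgt => /negP; apply.
by rewrite mulrC -ltr_pdivlMr.
Qed.

Lemma cf_map_cat v w (x : R) : cf_map R (v ++ w) x = cf_map R w (cf_map R v x).
Proof. by rewrite /cf_map foldl_cat. Qed.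

Lemma cf_map01 w (x : R) : all (leq 1) w -> 0 <= x <= 1 -> 0 <= cf_map R w x <= 1.
Proof.
elim: w x => [//|a w IH] x /andP[a1 w1] /andP[x0 x1].
have ha := natr_ge1 R _ a1.
rewrite cf_map_cons; apply: IH => //.
by rewrite invr_ge0 invf_le1; try lra; apply/andP; split; lra.
Qed.

(** The tails are limits of their convergents, and the recursion between convergents passes to the
    limit. *)
Lemma cf_expansion_exists d : (forall k, (0 < d k)%N) -> exists t, cf_expansion d t.
Proof.
move=> d0.
(* [u k n] is the [n]-th convergent of the [k]-th tail. *)
pose u k n := cf_map R (cf_prefix (fun i => d (k + i)%N) n) 0.
have z01 : 0 <= (0 : R) <= 1 by rewrite lexx ler01.
have u01 k n : 0 <= u k n <= 1 by apply: cf_map01 => //; exact: all_cf_prefix.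
have uS k n : u k n.+1 = ((d k)%:R + u k.+1 n)^-1.
  rewrite /u cf_prefix_rcons /cf_map foldl_rcons addn0.
  by rewrite (eq_cf_prefix _ (fun i => d (k.+1 + i)%N)) // => i _; rewrite addnS.
have /choice[t ht] : forall k, exists x, forall n, `|x - u k n| <= 2 * 2 ^- n.
  move=> k; apply: sup_squeeze => n m nm.
  pose b i := d (k + i)%N.
  have [v ve] := cf_prefix_catE b _ _ nm.
  have := all_cf_prefix b m (fun i => d0 _); rewrite ve all_cat => /andP[v1 w1].
  rewrite /u -/b ve cf_map_cat.
  apply: le_trans (cf_map_dist_le _ _ _ _ w1 z01 (cf_map01 _ _ v1 z01)) _.
  by rewrite ler_pM2l // -{2}(size_cf_prefix b n) cf_len_le.
have t01 k : 0 <= t k <= 1.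
  apply/andP; split; rewrite -subr_ge0 -oppr_le0; apply: (@le0_exprV2 _ 2) => n.
    by have := ht k n; have := u01 k n; rewrite ler_norml => /andP[? ?] /andP[? ?]; lra.
  by have := ht k n; have := u01 k n; rewrite ler_norml => /andP[? ?] /andP[? ?]; lra.
have tE k : t k = ((d k)%:R + t k.+1)^-1.
  apply/eqP; rewrite -subr_eq0 -normr_le0; apply: (@le0_exprV2 _ 4) => n.
  have hd := natr_ge1 R _ (d0 k).
  have /andP[t0 t1] := t01 k.+1; have /andP[u0 u1] := u01 k.+1 n.
  have h1 := ht k n.+1; have h2 := ht k.+1 n.
  have e : 2 ^- n.+1 = 2 ^- n / 2 :> R by rewrite exprS invfM mulrC.
  have p : 0 < 2 ^- n :> R by rewrite invr_gt0 exprn_gt0.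
  rewrite uS e in h1.
  have h3 : `|((d k)%:R + u k.+1 n)^-1 - ((d k)%:R + t k.+1)^-1| <= 2 * 2 ^- n.
    have -> : ((d k)%:R + u k.+1 n)^-1 - ((d k)%:R + t k.+1)^-1 =
       (t k.+1 - u k.+1 n) / (((d k)%:R + u k.+1 n) * ((d k)%:R + t k.+1)).
      by field; rewrite !gt_eqF; lra.
    have D : 1 <= ((d k)%:R + u k.+1 n) * ((d k)%:R + t k.+1) by nra.
    rewrite normrM normfV (ger0_norm (le_trans ler01 D)).
    rewrite ler_pdivrMr; last lra.
    by rewrite (le_trans h2) // ler_peMr //; lra.
  apply: le_trans (ler_distD ((d k)%:R + u k.+1 n)^-1 _ _) _.
  by lra.
exists t => k.
have tp j : 0 < t j.
  rewrite tE invr_gt0; have := natr_ge1 R _ (d0 j); have /andP[? ?] := t01 j.+1; lra.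
split=> //; rewrite tp /= tE invf_lt1; have := natr_ge1 R _ (d0 k); have := tp k.+1; lra.
Qed.

Lemma cf_expansion_digit d t k : cf_expansion d t -> flr (t k)^-1 = (d k)%:R.
Proof.
move=> dt; rewrite (dt k).2 invrK flr_natD //.
by have /andP[h1 ->] := (dt k.+1).1; rewrite ltW.
Qed.

Lemma cf_expansion_tail_eq d t i j : cf_expansion d t -> t i = t j ->
  forall m, d (i + m)%N = d (j + m)%N.
Proof.
move=> dt tij.
have h m : t (i + m)%N = t (j + m)%N.
  elim: m => [|m IH]; first by rewrite !addn0.
  have := congr1 (fun x => x^-1) IH; rewrite (dt (i + m)%N).2 (dt (j + m)%N).2 !invrK.
  rewrite !addnS; apply: natrD_inj;
    by [have /andP[h1 ->] := (dt (i + m).+1).1; rewrite ltW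
       |have /andP[h1 ->] := (dt (j + m).+1).1; rewrite ltW].
move=> m; apply/eqP; rewrite -(eqr_nat R) -!(cf_expansion_digit d t) //.
by rewrite h.
Qed.

End Expansions.

(** * Choosing digits that avoid a light family of words *)

Section Avoidance.
Variable R : realType.

(** If [w] is a suffix of [x], the entry of [x] just before it is the only possible [b.+1]. *)
Lemma sum_suffix_cons_le N (w x : seq nat) :
  (\sum_(b < N) suffix (b.+1 :: w) x <= suffix w x)%N.
Proof.
have [/suffixP[v xE]|nx] := boolP (suffix w x); last first.
  rewrite big1 // => b _; apply/eqP; rewrite eqb0; apply: contra nx.
  by apply: suffix_trans; exact: suffix_cons.
have bE (b : nat) : suffix (b.+1 :: w) x -> b = (last 0%N v).-1.
  move=> /suffixP[v']; rewrite xE -cat_rcons => e.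
  have sz : size v = size (rcons v' b.+1).
    by have /eqP := congr1 size e; rewrite !size_cat eqn_add2r => /eqP.
  by move/eqP: e; rewrite eqseq_cat // => /andP[/eqP -> _]; rewrite last_rcons.
have [/hasP[b0 _ hb0]|/hasPn h] := boolP (has (fun b : 'I_N => suffix (b.+1 :: w) x) (enum 'I_N)).
  rewrite (bigD1 b0) //= hb0 big1 ?addn0 // => b bb0; apply/eqP; rewrite eqb0.
  by apply: contra bb0 => /bE e; apply/eqP/val_inj => /=; rewrite e -(bE _ hb0).
by rewrite big1 // => b _; apply/eqP; rewrite eqb0 h // mem_enum.
Qed.

(** The part of the cost of the family [W] that falls inside the cylinder of [w]. *)
Definition words_weight (s : R) (W : nat -> seq (seq nat)) (w : seq nat) : \bar R :=
  (\sum_(0 <= q <oo) (\sum_(x <- W q | suffix w x) cf_len R x `^ s)%:E)%E.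

Lemma words_weight_children s W N w :
  (\sum_(b < N) words_weight s W (b.+1 :: w) <= words_weight s W w)%E.
Proof.
rewrite /words_weight -nneseries_sum; last first.
  by move=> b q _; rewrite lee_fin sumr_ge0 // => x _; exact: powR_ge0.
apply: lee_nneseries => q _.
  by move=> _; apply: sume_ge0 => b _; rewrite lee_fin sumr_ge0 // => x _; exact: powR_ge0.
rewrite sumEFin lee_fin.
under eq_bigr do rewrite big_mkcond.
rewrite exchange_big /= [leRHS]big_mkcond; apply: ler_sum => x _.
rewrite (eq_bigr (fun b : 'I_N => (suffix (b.+1 :: w) x)%:R * cf_len R x `^ s)); last first.
  by move=> b _; case: ifP => _; rewrite ?mul1r ?mul0r.
rewrite -mulr_suml -natr_sum.
have -> : (if suffix w x then cf_len R x `^ s else 0) = (suffix w x)%:R * cf_len R x `^ s.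
  by case: ifP => _; rewrite ?mul1r ?mul0r.
by rewrite ler_wpM2r ?powR_ge0 // ler_nat sum_suffix_cons_le.
Qed.

(** Thus a word weighing less than its own cost does not occur in the family. *)
Lemma words_weight_mem s W q w : w \in W q -> ((cf_len R w `^ s)%:E <= words_weight s W w)%E.
Proof.
move=> wq; rewrite /words_weight.
have p k : (0 <= (\sum_(x <- W k | suffix w x) cf_len R x `^ s)%:E)%E.
  by rewrite lee_fin sumr_ge0 // => x _; exact: powR_ge0.
rewrite (@nneseriesD1 _ _ q) // -[leLHS]adde0; apply: leeD; last exact: nneseries_ge0.
rewrite lee_fin (big_rem w) //= suffix_refl lerDl sumr_ge0 // => x _; exact: powR_ge0.
Qed.

(* A greedy choice of digits: as long as the words extending [w] weigh less than
   [w] itself, so do those extending one of its children. *)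
Lemma words_avoidance s N (W : nat -> seq (seq nat)) (n : nat) : (0 < n)%N -> s <= 1 ->
  1 <= N%:R / N.+2%:R * 2 `^ (1 - s) ->
  (words_weight s W [:: n] < (cf_len R [:: n] `^ s)%:E)%E ->
  exists d : nat -> nat, [/\ d 0%N = n, forall k, (0 < d k.+1 <= N)%N
    & forall k q, cf_prefix d k.+1 \notin W q].
Proof.
move=> n0 s1 hN h0.
pose light w := all (leq 1) w /\ (words_weight s W w < (cf_len R w `^ s)%:E)%E.
have /choice[f hf] : forall w, exists b : nat, light w -> (b < N)%N /\ light (b.+1 :: w).
  move=> w; have [[w1 hw]|nl] := pselect (light w); last by exists 0%N.
  have [[b hb]|nb] := pselect (exists b : 'I_N,
      (words_weight s W (b.+1 :: w) < (cf_len R (b.+1 :: w) `^ s)%:E)%E).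
    by exists b => _; split.
  (* Were no child light, the children would together weigh at least the sum of their own costs,
     hence at least that of [w]. *)
  exfalso; move: hw; rewrite ltNge => /negP; apply.
  apply: le_trans (words_weight_children s W N w).
  apply: (@le_trans _ _ (\sum_(b < N) (cf_len R (b.+1 :: w) `^ s)%:E)%E).
    by rewrite sumEFin lee_fin; exact: cf_len_powR_sum.
  apply: lee_sum => b _; rewrite leNgt; apply/negP => hb.
  by apply: nb; exists b.
pose wd k := iter k (fun w => (f w).+1 :: w) [:: n].
have wl k : light (wd k).
  elim: k => [|k IH]; first by split=> //=; rewrite n0.
  by have [] := hf _ IH.
pose d k := head 0%N (wd k).
have pE k : cf_prefix d k.+1 = wd k by elim: k => //= k ->.
exists d; split=> //.
  by move=> k; rewrite /d /=; have [] := hf _ (wl k).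
move=> k q; rewrite pE; apply/negP => /(words_weight_mem s).
by rewrite leNgt (wl k).2.
Qed.

End Avoidance.

(** * Lower bound for the cost of covers *)

Section LowerBound.
Variables (R : realType) (N : nat).

(** The leading digit [N.+3] is large enough that [a = 1 - t 0] is at least [1 - 1 / (N + 2)], which
    bounds all later tails. *)
Definition admissible (d : nat -> nat) (t : nat -> R) :=
  [/\ d 0%N = N.+3, forall k, (0 < d k.+1 <= N)%N & cf_expansion R d t].

Lemma admissible_gt0 d t : admissible d t -> forall k, (0 < d k)%N.
Proof. by case=> d0 dN _ [|k]; [rewrite d0 | case/andP: (dN k)]. Qed.

Lemma inv1D_invS : (1 + N.+1%:R^-1)^-1 = 1 - N.+2%:R^-1 :> R.
Proof.
have n0 : 0 <= N%:R :> R by [].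
rewrite -[N.+2]addn2 -[N.+1]addn1 !natrD.
by field; rewrite !gt_eqF; lra.
Qed.

Lemma admissible_tail d t k : admissible d t ->
  N.+1%:R^-1 <= t k.+1 <= 1 - N.+2%:R^-1.
Proof.
case=> d0 dN dt.
have lb j : N.+1%:R^-1 <= t j.+1.
  have /andP[d1 d2] := dN j; have /andP[t0 t1] := (dt j.+2).1.
  have ha := natr_ge1 R _ d1.
  rewrite (dt j.+1).2 lef_pV2 ?posrE //; last lra.
  have : (d j.+1)%:R <= N%:R :> R by rewrite ler_nat.
  by rewrite -natr1; lra.
rewrite lb /=.
have /andP[d1 d2] := dN k; have /andP[t0 t1] := (dt k.+2).1.
have ha := natr_ge1 R _ d1; have hb := lb k.+1.
have n0 : 0 <= N%:R :> R by [].
rewrite (dt k.+1).2.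
apply: (@le_trans _ _ (1 + N.+1%:R^-1)^-1).
  have m0 : 0 < N.+1%:R^-1 :> R by rewrite invr_gt0.
  move: (N.+1%:R^-1) m0 hb => m m0 hb.
  by rewrite lef_pV2 ?posrE; lra.
by rewrite inv1D_invS.
Qed.

Lemma admissible_nonmatching d t : admissible d t ->
  (forall i j, t i.+1 = t j.+1 -> i = j) -> @nonmatching_set R (1 - t 0%N).
Proof.
move=> adm tinj; have [d0 dN dt] := adm.
have n0 : 0 <= N%:R :> R by [].
have /andP[t1 t2] := (dt 1%N).1; have /andP[t01 t02] := (dt 0%N).1.
have tN : t 0%N <= N.+2%:R^-1.
  have N3 : N.+2%:R <= N.+3%:R :> R by rewrite ler_nat.
  have N2 : 0 < N.+2%:R :> R by [].
  rewrite (dt 0%N).2 d0; move: (N.+2%:R : R) (N.+3%:R : R) N2 N3 => x y x0 xy.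
  by rewrite lef_pV2 ?posrE; lra.
have N2 : N.+2%:R^-1 <= 2^-1 :> R by rewrite lef_pV2 ?posrE // ler_nat.
have t0h : t 0%N < 2^-1.
  have N3 : 2 <= N.+3%:R :> R by rewrite ler_nat.
  by rewrite (dt 0%N).2 d0 ltf_pV2 ?posrE //; lra.
split; first by apply/andP; split; lra.
apply: (@nonmatching_of_expansion R _ d t) => //.
- by apply/andP; split; lra.
- by rewrite subKr.
- exact: admissible_gt0 adm.
- by move=> k; have [] := dt k.
- by move=> k; rewrite (dt k).2 invrK.
- move=> k; have /andP[_ h] := admissible_tail _ _ k adm.
  by apply: (le_trans h); rewrite lerD2l lerN2.
move=> k; have /andP[h _] := admissible_tail _ _ k adm.
have N1 : 0 < N.+1%:R^-1 :> R by rewrite invr_gt0.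
apply: (@le_trans _ _ (1 + N.+1%:R^-1)^-1).
  by move: (N.+1%:R^-1) N1 h => m m0 h; rewrite lef_pV2 ?posrE; lra.
by rewrite inv1D_invS lerD2l lerN2.
Qed.

Lemma small_prefix d (s e : R) : 0 < s -> 0 < e -> (forall k, (0 < d k)%N) ->
  exists k, cf_len R (cf_prefix d k.+1) `^ s <= e.
Proof.
move=> s0 e0 d0; have [k hk] := exists_exprV2_lt R (e `^ s^-1) (powR_gt0 _ e0).
have a1 := all_cf_prefix d k.+1 d0.
exists k; have -> : e = (e `^ s^-1) `^ s by rewrite -powRrM mulVf ?powRr1 ?gt_eqF // ltW.
apply: ge0_ler_powR; rewrite ?nnegrE ?powR_ge0 //; first exact: ltW.
  exact/ltW/cf_len_gt0.
apply: le_trans (cf_len_le R _ a1) _; rewrite size_cf_prefix.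
apply: le_trans (ltW hk); rewrite exprS invfM ler_piMl ?invr_ge0 ?exprn_ge0 //; lra.
Qed.

(** The word is the longest common prefix of the admissible expansions met by [U]: two of them
    differ at the next digit, so by [cf_map_gap] its length is at most a constant times the
    diameter. With a single digit sequence in [U], a prefix of cost at most [e] is used instead. *)
Lemma set_words (U : set R) (s e : R) : 0 < s -> 0 < e -> (diam U <= 1)%E ->
  exists l : seq (seq nat),
    ((\sum_(x <- l) cf_len R x `^ s)%:E <=
       ((2 * N.+2%:R ^+ 3) `^ s)%:E * diam_pow s U + e%:E)%E /\
    forall d t, admissible d t -> U (1 - t 0%N) ->
      exists k, cf_prefix d k.+1 \in l.
Proof.
move=> s0 e0 dU.
have [[d [t [adm Ut]]]|none] :=
    pselect (exists d t, admissible d t /\ U (1 - t 0%N)); last first.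
  exists [::]; rewrite big_nil; split; last first.
    by move=> d t adm Ut; exfalso; apply: none; exists d, t.
  apply: adde_ge0; last by rewrite lee_fin ltW.
  by rewrite mule_ge0 ?lee_fin ?powR_ge0 ?diam_pow_ge0.
have d0 := admissible_gt0 _ _ adm.
(* The least [k] with [P k] is the length of the common prefix. *)
pose P k := `[< exists d' t', [/\ admissible d' t', U (1 - t' 0%N) & d' k != d k] >].
have [exP|nP] := pselect (exists k, P k); last first.
  have [k hk] := small_prefix d s e s0 e0 d0.
  exists [:: cf_prefix d k.+1]; rewrite big_seq1; split.
    rewrite -[leLHS]add0e leeD ?lee_fin //.
    by rewrite mule_ge0 ?lee_fin ?powR_ge0 ?diam_pow_ge0.
  move=> d' t' adm' Ut'; exists k; rewrite inE; apply/eqP.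
  apply: eq_cf_prefix => i _; apply/eqP; apply/negPn/negP => h.
  by apply: nP; exists i; apply/asboolP; exists d', t'.
case: (ex_minnP exP) => k /asboolP[d' [t' [adm' Ut' dk]]] kmin.
have agree d1 t1 : admissible d1 t1 -> U (1 - t1 0%N) ->
    cf_prefix d1 k = cf_prefix d k.
  move=> adm1 Ut1; apply: eq_cf_prefix => i ik; apply/eqP/negPn/negP => h.
  have /kmin : P i by apply/asboolP; exists d1, t1.
  by rewrite leqNgt ik.
(* The first digit is always [N.+3], so the sequences part at an index where digits lie between 1
   and [N]. *)
case: k dk kmin agree => [|k] dk kmin agree.
  by case: adm adm' dk => -> _ _ [-> _ _]; rewrite eqxx.
exists [:: cf_prefix d k.+1]; rewrite big_seq1; split; last first.
  by move=> d1 t1 adm1 Ut1; exists k; rewrite inE (agree _ _ adm1 Ut1).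
have [_ dN dt] := adm; have [_ dN' dt'] := adm'.
have w1 := all_cf_prefix d k.+1 d0.
have b01 d1 t1 : admissible d1 t1 -> 0 <= t1 k.+2 <= 1 - N.+2%:R^-1.
  move=> /(admissible_tail _ _ k.+1)/andP[h ->].
  by rewrite andbT; apply: le_trans h; rewrite invr_ge0.
have := cf_map_gap R N _ _ _ _ _ w1 (dN k) (dN' k) _ (b01 _ _ adm) (b01 _ _ adm').
rewrite eq_sym => /(_ dk).
rewrite -[d k.+1 :: _]/(cf_prefix d k.+2) -(cf_expansion_prefix R _ _ k.+2 dt).
rewrite -(agree _ _ adm' Ut') -[d' k.+1 :: _]/(cf_prefix d' k.+2).
rewrite -(cf_expansion_prefix R _ _ k.+2 dt') (agree _ _ adm' Ut') => gap.
have fU : diam U \is a fin_num by rewrite ge0_fin_numE ?diam_ge0 // (le_lt_trans dU) ?ltry.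
have tU : `|t 0%N - t' 0%N| <= fine (diam U).
  rewrite -lee_fin fineK //; apply: ereal_sup_ubound; right.
  exists (1 - t 0%N, 1 - t' 0%N) => //=; congr (_%:E).
  by rewrite distrC; congr (`|_|); ring.
have -> : diam_pow s U = (fine (diam U) `^ s)%:E.
  by rewrite /diam_pow; case: pselect => //= U0; move: Ut; rewrite U0.
rewrite -[leLHS]adde0 leeD ?lee_fin ?(ltW e0) // -powRM ?fine_ge0 ?diam_ge0 //.
have l0 := cf_len_gt0 R _ w1.
apply: ge0_ler_powR; rewrite ?nnegrE ?mulr_ge0 ?fine_ge0 ?diam_ge0 //; try exact: ltW.
have := le_trans gap tU.
by rewrite ler_pdivrMr ?mulr_gt0 ?exprn_gt0 // [leRHS]mulrC.
Qed.

(** [p] holds an initial list and the index where its period starts; being countable data, such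
    pairs are enumerated by [unpickle]. *)
Definition periodic_digits (p : seq nat * nat) (m : nat) : nat :=
  nth 0%N p.1 (if (m < p.2)%N then m else p.2 + (m - p.2) %% (size p.1 - p.2))%N.

Lemma periodic_digitsP (d : nat -> nat) i j : (i < j)%N ->
  (forall m, d (i + m)%N = d (j + m)%N) ->
  forall m, d m = periodic_digits (mkseq d j, i) m.
Proof.
move=> ij h m; rewrite /periodic_digits /= size_mkseq.
have [mi|im] := ltnP m i; first by rewrite nth_mkseq // (ltn_trans mi).
have p0 : (0 < j - i)%N by rewrite subn_gt0.
have lt r : (i + r %% (j - i) < j)%N.
  by have := ltn_pmod r p0; lia.
rewrite nth_mkseq // -{1}(subnKC im) {1}(divn_eq (m - i) (j - i)).
elim: (_ %/ _)%N => [|c IH]; first by rewrite mul0n add0n.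
by rewrite -IH [in RHS]h mulSn; congr (d _); lia.
Qed.

(** One prefix catches the [q]-th ultimately periodic sequence; [e] will be chosen summable over
    [q]. *)
Lemma periodic_words (s e : R) (q : nat) : 0 < s -> 0 < e ->
  exists l : seq (seq nat), \sum_(x <- l) cf_len R x `^ s <= e /\
    forall d p, unpickle q = Some p -> (forall k, (0 < d k)%N) ->
      (forall m, d m = periodic_digits p m) -> exists k, cf_prefix d k.+1 \in l.
Proof.
move=> s0 e0; case: (unpickle q) => [p|]; last first.
  by exists [::]; rewrite big_nil; split => //; exact: ltW.
have [p0|np] := pselect (forall k, (0 < periodic_digits p k)%N); last first.
  exists [::]; rewrite big_nil; split; first exact: ltW.
  move=> d _ [<-] d0 dp; exfalso; apply: np => k; by rewrite -dp.
have [k hk] := small_prefix _ s e s0 e0 p0.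
exists [:: cf_prefix (periodic_digits p) k.+1]; rewrite big_seq1; split=> //.
move=> d _ [<-] d0 dp; exists k; rewrite inE; apply/eqP.
by apply: eq_cf_prefix => i _.
Qed.

Lemma nonmatching_content_gt0 (s : R) : 0 < s <= 1 -> 1 <= N%:R / N.+2%:R * 2 `^ (1 - s) ->
  exists2 c : R, 0 < c & forall U : nat -> set R, delta_cover 1 (@nonmatching_set R) U ->
    (c%:E <= \sum_(0 <= q <oo) diam_pow s (U q))%E.
Proof.
move=> /andP[s0 s1] hN.
pose C : R := (2 * N.+2%:R ^+ 3) `^ s.
have C0 : 0 < C by rewrite powR_gt0 // mulr_gt0 // exprn_gt0.
pose L : R := cf_len R [:: N.+3] `^ s.
have L0 : 0 < L by apply/powR_gt0/cf_len_gt0.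
(* [C] is the constant of [set_words], so a cover cheaper than this yields words costing less than
   [L / 2]; the errors add [L / 4], still below [L]. *)
exists (L / 2 / C); first by rewrite !divr_gt0.
move=> U [Ucov Ud]; rewrite leNgt; apply/negP => Usum.
(* [L / 4] is spread geometrically over [q] and halved between the words of [U q] and the periodic
   ones. *)
have e0 q : 0 < L / 4 / (2 ^ q.+1)%:R / 2 by rewrite !divr_gt0 // ltr0n expn_gt0.
have /choice[lU hU] := fun q => set_words (U q) s _ s0 (e0 q) (Ud q).
have /choice[lP hP] := fun q => periodic_words s _ q s0 (e0 q).
pose W q := lU q ++ lP q.
have dp0 q := diam_pow_ge0 R (U q) s.
have Wlt : (words_weight R s W [:: N.+3] < L%:E)%E.
  apply: (@le_lt_trans _ _ (\sum_(0 <= q <oo)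
      (C%:E * diam_pow s (U q) + (L / 4 / (2 ^ q.+1)%:R)%:E))%E).
    apply: lee_nneseries => q _.
      by move=> _; rewrite lee_fin sumr_ge0 // => x _; exact: powR_ge0.
    apply: (@le_trans _ _ (\sum_(x <- W q) cf_len R x `^ s)%:E).
      rewrite lee_fin big_mkcond /=; apply: ler_sum => x _.
      by case: ifP => // _; exact: powR_ge0.
    rewrite big_cat EFinD [in leRHS](splitr (L / 4 / (2 ^ q.+1)%:R)) EFinD addeA.
    by apply: leeD; [exact: (hU q).1 | rewrite lee_fin; exact: (hP q).1].
  apply: le_lt_trans (epsilon_trick _ _ _) _.
  - by move=> q; rewrite mule_ge0 ?lee_fin ?(ltW C0).
  - by rewrite divr_ge0 // ltW.
  rewrite nneseriesZl //.
  apply: (@lt_le_trans _ _ (C%:E * (L / 2 / C)%:E + (L / 4)%:E)%E).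
    by rewrite lteD2rE // lte_pmul2l ?lte_fin.
  rewrite -EFinM -EFinD lee_fin [C * _]mulrC divfK ?gt_eqF //; lra.
have [d [d0 dN dW]] := words_avoidance R s N W N.+3 isT s1 hN Wlt.
have dpos k : (0 < d k)%N by case: k => [|k]; [rewrite d0 | case/andP: (dN k)].
have [t dt] := cf_expansion_exists R d dpos.
have adm : admissible d t by split.
(* A repeated tail would make [d] ultimately periodic, and one of its prefixes would lie in some
   [lP q]. *)
have inj i j : t i.+1 = t j.+1 -> i = j.
  have key i' j' : (i' < j')%N -> t i'.+1 = t j'.+1 -> False.
    move=> ij /(cf_expansion_tail_eq R d t _ _ dt) h.
    pose p := (mkseq d j'.+1, i'.+1).
    have [k hk] := (hP (pickle p)).2 d p (pickleK p) dpos (periodic_digitsP d i'.+1 j'.+1 ij h).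
    by have := dW k (pickle p); rewrite mem_cat hk orbT.
  move=> tij; case: (ltngtP i j) => // ij.
    by case: (key _ _ ij tij).
  by case: (key _ _ ij (esym tij)).
(* The point obtained is non-matching and so lies in some [U q], yet no prefix of [d] is in
   [lU q]. *)
have /Ucov[q _ Uq] := admissible_nonmatching d t adm inj.
have [k hk] := (hU q).2 d t adm Uq.
by have := dW k q; rewrite mem_cat hk.
Qed.

End LowerBound.

(** * Positive Hausdorff measure for exponents below 1, and the theorem *)

Section Main.
Variable R : realType.

(** [p = 2^(1 - s)] exceeds 1 while [N / (N + 2)] tends to 1; it suffices that [N (p - 1) >= 2]. *)
Lemma exists_alphabet_size (s : R) : s < 1 ->
  exists N : nat, 1 <= N%:R / N.+2%:R * 2 `^ (1 - s).
Proof.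
move=> s1; pose p : R := 2 `^ (1 - s).
have p1 : 1 < p.
  have <- : 1 `^ (1 - s) = 1 :> R by rewrite powR1.
  by rewrite gt0_ltr_powR ?nnegrE ?subr_gt0 ?ltr1n.
exists (Num.trunc (2 / (p - 1))).+1.
have := truncnS_gt (2 / (p - 1)).
set n := (Num.trunc _).+1; rewrite ltr_pdivrMr => [hn|]; last lra.
rewrite mulrAC ler_pdivlMr // mul1r -/p -[n.+2]addn2 natrD; lra.
Qed.

Lemma diam_pow_anti (U : set R) (s r : R) : 0 < r -> s <= r -> (diam U <= 1)%E ->
  (diam_pow r U <= diam_pow s U)%E.
Proof.
move=> r0 sr dU; rewrite /diam_pow; case: pselect => //= U0.
have fU : diam U \is a fin_num by rewrite ge0_fin_numE ?diam_ge0 // (le_lt_trans dU) ?ltry.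
have := fine_ge0 (diam_ge0 R U); rewrite lee_fin le_eqVlt => /predU1P[<-|f0].
  by rewrite powR0 ?gt_eqF // powR_ge0.
by apply: ger_powR => //; rewrite f0 -lee_fin fineK.
Qed.

Lemma hausdorff_measure_nonmatching (s : R) : 0 <= s < 1 ->
  hausdorff_measure s (@nonmatching_set R) <> 0%E.
Proof.
move=> /andP[s0 s1] H0.
(* The content bound asks for a positive exponent, so [s] is raised to [r]; sets of diameter at most
   1 do not get more costly. *)
pose r := Num.max s 2^-1.
have r0 : 0 < r by rewrite /r lt_max invr_gt0 ltr0n orbT.
have r1 : r < 1 by rewrite /r gt_max s1 /=; lra.
have sr : s <= r by rewrite /r le_max lexx.
have [N hN] := exists_alphabet_size r r1.
have [|c c0 hc] := nonmatching_content_gt0 R N r _ hN; first by rewrite r0 ltW.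
suff : (c%:E <= hausdorff_measure s (@nonmatching_set R))%E.
  by rewrite H0 lee_fin leNgt c0.
apply: le_ereal_sup_tmp; exists (hausdorff_content s 1 (@nonmatching_set R)).
  by exists 1 => //=; exact: ltr01.
apply: le_ereal_inf_tmp => _ [U Ucov <-].
apply: (le_trans (hc U Ucov)); apply: lee_nneseries => q _.
  by move=> _; exact: diam_pow_ge0.
by apply: diam_pow_anti => //; exact: Ucov.2.
Qed.
End Main.

Theorem theorem1p1 (R : realType) :
  (@lebesgue_measure R).-negligible (@nonmatching_set R) /\
  hausdorff_dim (@nonmatching_set R) = 1%E.
Proof.
split; first exact: nonmatching_null.
apply/eqP; rewrite eq_le; apply/andP; split.
  by apply: hausdorff_dim_unit_itv => a [/andP[a0 a1] _] /=; rewrite ltW.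
apply: le_ereal_inf_tmp => _ [s [s0 Hs] <-]; rewrite lee_fin leNgt; apply/negP => s1.
by apply: (hausdorff_measure_nonmatching R s) => //; rewrite s0.
Qed.
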